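(* Let $G$ be a finite simple graph. Then $\gamma_P(G)=1$ if and only if $G$ is a graph of $k$ internally parallel paths for some $k$.
   Context: Power domination: for a set $S$, first color blue all vertices of $S$ and all their neighbors; then repeatedly, whenever a blue vertex has exactly one non-blue neighbor, color that neighbor blue. $S$ is a power dominating set if eventually all vertices are blue; $\gamma_P(G)$ is the minimum size of a power dominating set. For a path $P: a_1,a_2,\ldots,a_m$ and a vertex $a_i$ of $P$, ${}^{a_i}P$ denotes the subpath $a_{i+1},\ldots,a_m$. $G$ is a graph of $k$ internally parallel paths if there is a vertex $x\in V(G)$ and $k$ paths $Q_1,\ldots,Q_k$, each an induced path of $G$ having $x$ as an end-vertex, with $V(Q_i)\cap V(Q_j)=\{x\}$ for $i\ne j$ and $V(G)=\bigcup_{i=1}^k V(Q_i)$ (so $E(G)$ consists of the path edges together with any number of edges joining vertices of different paths), such that the following holds: for every choice of $\ell\le k$ vertices $x_{i_1}\in V(Q_{i_1}),\ldots,x_{i_\ell}\in V(Q_{i_\ell})$ lying on pairwise distinct paths, none of which is an end-vertex of its path, there exists $x'\in\{x_{i_1},\ldots,x_{i_\ell}\}$ with exactly one neighbor in $Y=V({}^{x_{i_1}}Q_{i_1})\cup\cdots\cup V({}^{x_{i_\ell}}Q_{i_\ell})$, where each $Q_{i}$ is traversed starting from $x$. *)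

(* Defs.v *)
From mathcomp Require Import all_boot.

Set Implicit Arguments.
Unset Strict Implicit.
Unset Printing Implicit Defensive.

(* A finite simple graph is a symmetric irreflexive relation e on a finType V;
   the definitions below take e alone. *)

Section PowerDomination.
Variables (V : finType) (e : rel V).
Implicit Types (S B : {set V}) (u v w : V).

Definition closed_nbhd S : {set V} := [set v | (v \in S) || [exists u in S, e u v]].

Definition nonblue_nbrs B v : {set V} := [set u | e v u && (u \notin B)].

(* One parallel round: every vertex that some blue vertex can force turns blue. *)
Definition force_step B : {set V} :=
  B :|: [set w | [exists v in B, nonblue_nbrs B v == [set w]]].

Definition blue_after (t : nat) S : {set V} := iter t force_step (closed_nbhd S).

(* The blue set is stationary after at most #|V| rounds; power_dominatingP
   below shows that this is "all vertices are eventually blue". *)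
Definition power_dominating S : bool := blue_after #|V| S == [set: V].

(* The full vertex set [set: V] is always power dominating (power_dominatingT),
   so the arg min ranges over a nonempty family. *)
Definition power_domination_number : nat :=
  #|[arg min_(S < [set: V] | power_dominating S) #|S| ]|.

Lemma subset_force_step B : B \subset force_step B.
Proof. exact: subsetUl. Qed.

Lemma blue_afterS t S : blue_after t S \subset blue_after t.+1 S.
Proof. exact: subset_force_step. Qed.

Lemma blue_after_sub s t S :
  s <= t -> blue_after s S \subset blue_after t S.
Proof.
move=> /subnKC <-; elim: (t - s) => [|d IH]; first by rewrite addn0.
by rewrite addnS; apply: subset_trans IH (blue_afterS _ _).
Qed.

Lemma blue_after_stable s d S :
  blue_after s.+1 S = blue_after s S -> blue_after (s + d) S = blue_after s S.
Proof.
move=> eqs; elim: d => [|d IH]; first by rewrite addn0.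
by rewrite addnS -[LHS]/(force_step (blue_after (s + d) S)) IH.
Qed.

Lemma blue_after_card t S :
  t <= #|blue_after t S|
  \/ exists2 s, s < t & blue_after s.+1 S = blue_after s S.
Proof.
elim: t => [|t [IH|[s lt_st eqs]]]; first by left.
- have [eqt|neq] := eqVneq (blue_after t.+1 S) (blue_after t S).
    by right; exists t.
  left; apply: leq_ltn_trans IH _; apply: proper_card.
  by rewrite properEneq eq_sym neq blue_afterS.
- by right; exists s => //; apply: ltnW.
Qed.

Lemma power_dominatingP S :
  reflect (exists t, blue_after t S = [set: V]) (power_dominating S).
Proof.
apply: (iffP eqP) => [?|[t eqT]]; first by exists #|V|.
have [le_V|[s lt_s eqs]] := blue_after_card #|V| S.
  by apply/eqP; rewrite eqEcard subsetT cardsT.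
have [le_tV|/ltnW le_Vt] := leqP t #|V|.
  by apply/eqP; rewrite eqEsubset subsetT -eqT blue_after_sub.
rewrite -eqT -(subnKC (ltnW lt_s)) -(subnKC (leq_trans (ltnW lt_s) le_Vt)).
by rewrite !blue_after_stable.
Qed.

Lemma power_dominatingT : power_dominating [set: V].
Proof.
apply/power_dominatingP; exists 0; apply/setP=> v.
by rewrite /blue_after /= !inE.
Qed.

Lemma power_domination_numberP n :
  power_domination_number = n <->
    (exists2 S, power_dominating S & #|S| = n)
    /\ (forall S, power_dominating S -> n <= #|S|).
Proof.
rewrite /power_domination_number; case: arg_minnP => [|S0 pS0 minS0].
  exact: power_dominatingT.
split=> [<-|[[S pS <-] minS]]; first by split=> //; exists S0.
by apply/eqP; rewrite eqn_leq minS0 // minS.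
Qed.

End PowerDomination.

Section ParallelPaths.
Variables (V : finType) (e : rel V).

(* p lists pairwise distinct vertices, two of which are adjacent in the graph
   exactly when they are consecutive in p; a one-vertex path is allowed. *)
Definition induced_path (p : seq V) : Prop :=
  [/\ p != [::], uniq p &
      {in p &, forall u v,
         e u v = (index v p == (index u p).+1) || (index u p == (index v p).+1)}].

(* Meaningful for v \in p: the default value of head and last is then unused. *)
Definition end_vertex (p : seq V) (v : V) : bool :=
  (v == head v p) || (v == last v p).

(* The subpath ^v p: the vertices of p strictly after v. *)
Definition subpath_after (p : seq V) (v : V) : seq V := drop (index v p).+1 p.

(* Each Q i is listed starting from the common end-vertex x.  A choice of
   l <= k vertices on pairwise distinct paths is a nonempty index set I
   (with #|I| = l) and a vertex y i of Q i for each i \in I. *)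
Definition internally_parallel_paths (k : nat) : Prop :=
  exists (x : V) (Q : 'I_k -> seq V),
    [/\ forall i, induced_path (Q i) /\ ohead (Q i) = Some x,
        forall i j, i != j -> [set v in Q i] :&: [set v in Q j] = [set x],
        \bigcup_(i < k) [set v in Q i] = [set: V] &
        forall (I : {set 'I_k}) (y : 'I_k -> V),
          I != set0 ->
          (forall i, i \in I -> y i \in Q i /\ ~~ end_vertex (Q i) (y i)) ->
          let Y := \bigcup_(j in I) [set v in subpath_after (Q j) (y j)] in
          exists2 i, i \in I & #|[set u in Y | e (y i) u]| = 1].

End ParallelPaths.

(* Main.v *)
(** Colour from a single vertex [x].  If [{x}] is power dominating, fix for every
    vertex outside [N[x]] one vertex that forces it; the forcing chains starting
    at the neighbours of [x] are the parallel paths, and among chosen vertices on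
    distinct chains the one that forces first sees only its own successor in
    [Y], because all of [Y] turns blue no earlier than that successor.
    Conversely, if colouring from [x] stalls at a blue set [B], apply the
    hypothesis to the vertices preceding the first non-blue vertex of each path
    that is not entirely blue: one of them has a unique neighbour in [Y], which
    contains every non-blue vertex, hence it can still force. *)
Require Import Defs.
From mathcomp Require Import all_boot.

Set Implicit Arguments.
Unset Strict Implicit.
Unset Printing Implicit Defensive.

(** * Subpaths and induced paths in list form *)

Lemma subpath_after_cat (V : finType) (s1 s2 : seq V) (y : V) :
  y \notin s1 -> subpath_after (s1 ++ y :: s2) y = s2.
Proof.
move=> ys1; rewrite /subpath_after index_cat (negPf ys1) /= eqxx addn0.
by rewrite -cat_rcons drop_size_cat ?size_rcons.
Qed.

Section ForcingChains.
Variables (V : finType) (e : rel V).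
Hypotheses (e_sym : symmetric e) (e_irr : irreflexive e).

(** Symmetry and irreflexivity of [e] reduce the adjacency condition to pairs of positions
    [i < j]. *)
Lemma induced_path_nth (x0 : V) (s : seq V) :
  s != [::] -> uniq s ->
  (forall i j, i < j < size s -> e (nth x0 s i) (nth x0 s j) = (j == i.+1)) ->
  induced_path e s.
Proof.
move=> s0 us H; split=> // u v us' vs'.
have := H (index u s) (index v s); have := H (index v s) (index u s).
rewrite !nth_index // !index_mem us' vs' !andbT.
case: (ltngtP (index u s) (index v s)) => [lt _ /(_ isT) ->|lt /(_ isT) + _|eq _ _].
- by rewrite [index u s == _]ltn_eqF ?orbF // ltnS ltnW.
- by rewrite e_sym => ->; rewrite [index v s == _]ltn_eqF // ltnS ltnW.
- rewrite -(nth_index x0 us') -(nth_index x0 vs') eq e_irr.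
  by rewrite nth_index // ltn_eqF.
Qed.

Variable x : V.

(** * Parallel paths from a ranking of the vertices by forcing time *)

Section Ranked.
(** Think of [rk v] as the round in which [v] turns blue from [x], and of [par v] as a chosen vertex
    that forces [v]; where [rk v = 0], [par v] is arbitrary. *)
Variables (rk : V -> nat) (par : V -> V).
Hypothesis rk0 : forall v, (rk v == 0) = (v == x) || e x v.
Hypothesis par_rk : forall v, 0 < rk v -> rk (par v) < rk v.
Hypothesis par_adj : forall v, 0 < rk v -> e (par v) v.
Hypothesis par_force : forall v w,
  0 < rk v -> e (par v) w -> w != v -> rk w < rk v.

Let forces u v := (0 < rk v) && (par v == u).

Lemma forces_rk u v : forces u v -> rk u < rk v.
Proof. by case/andP=> v0 /eqP <-; apply: par_rk. Qed.

Lemma forces_adj u v : forces u v -> e u v.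
Proof. by case/andP=> v0 /eqP <-; apply: par_adj. Qed.

Lemma forces_nbr u v w : forces u v -> e u w -> w != v -> rk w < rk v.
Proof. by case/andP=> v0 /eqP <-; apply: par_force. Qed.

(** If [u] forced two vertices, each would be a further neighbour of [u] and so rank strictly below
    the other. *)
Lemma forces_fun u v w : forces u v -> forces u w -> v = w.
Proof.
move=> uv uw; apply/eqP/negPn/negP => nvw.
have := forces_nbr uw (forces_adj uv) nvw.
by rewrite ltnNge ltnW // (forces_nbr uv (forces_adj uw)) // eq_sym.
Qed.

(** Ranks increase strictly along [forces] and are bounded, so a chain extended greedily stops. *)
Lemma maximal_chain u :
  exists p, path forces u p /\ forall w, ~~ forces (last u p) w.
Proof.
have [m] := ubnP (\max_v rk v - rk u).
elim: m u => // m IH u lt_m.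
have [w /= uw|nf] := pickP (forces u); last by exists [::]; split=> // w; rewrite nf.
have le_w : rk w <= \max_v rk v by apply: leq_bigmax.
have ltuw := forces_rk uw.
have [|p [pp pl]] := IH w.
  by apply: leq_trans (ltn_sub2l _ ltuw) lt_m; apply: leq_trans ltuw le_w.
by exists (w :: p); rewrite /= uw.
Qed.

Lemma chain_rk s : sorted forces s -> sorted (fun u v => rk u < rk v) s.
Proof. by apply: sub_sorted; apply: forces_rk. Qed.

Lemma rk_ltn_trans : transitive (fun u v => rk u < rk v).
Proof. by move=> v u w; apply: ltn_trans. Qed.

Lemma chain_rk_gt n p v : path forces n p -> v \in p -> rk n < rk v.
Proof.
move=> pp vp; have {}pp := chain_rk (s := n :: p) pp.
by have /allP/(_ _ vp) := order_path_min rk_ltn_trans pp.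
Qed.

Lemma chain_uniq n p : path forces n p -> uniq (n :: p).
Proof.
move=> /(@chain_rk (n :: p)); apply: sorted_uniq rk_ltn_trans _ _ => u.
exact: ltnn.
Qed.

Lemma chain_par n p v : path forces n p -> v \in p -> 0 < rk v /\ par v \in n :: p.
Proof.
move=> pp vp; case/splitPr: vp pp => p1 p2.
rewrite cat_path /= => /and3P[_ /andP[v0 /eqP ->] _]; split=> //.
by rewrite -cat_cons mem_cat mem_last.
Qed.

Lemma chain_next n p u v : path forces n p -> (forall w, ~~ forces (last n p) w) ->
  u \in n :: p -> forces u v -> v \in n :: p.
Proof.
move=> pp pl up; case/splitPl: up pp pl => p1 [|w p2] lu; rewrite cat_path last_cat lu.
  by move=> _ /(_ v)/negPf /= ->.
move=> /= /and3P[_ uw _] _ uv.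
by rewrite (forces_fun uv uw) -cat_cons mem_cat mem_head orbT.
Qed.

(** Follow a common vertex back through [par]: parents stay in both chains and ranks drop until one
    head is reached. A head has rank 0, and in the other chain only the head has rank 0. *)
Lemma chain_disjoint n n' p p' v : rk n = 0 -> rk n' = 0 ->
  path forces n p -> path forces n' p' -> v \in n :: p -> v \in n' :: p' -> n = n'.
Proof.
move=> n0 n0' pp pp'; have [m] := ubnP (rk v); elim: m v => // m IH v lt_m.
rewrite inE => /predU1P[->|vp] vp'.
  move: vp'; rewrite inE => /predU1P[//|/(chain_par pp')[]]; by rewrite n0.
have [v0 pv] := chain_par pp vp.
move: vp'; rewrite inE => /predU1P[eqv|/(chain_par pp')[_ pv']].
  by rewrite eqv n0' in v0.
by apply: IH pv pv'; apply: leq_trans (par_rk v0) _.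
Qed.

Lemma rk_nbr n : e x n -> rk n = 0.
Proof. by move=> xn; apply/eqP; rewrite rk0 xn orbT. Qed.

Lemma rk_root : rk x = 0.
Proof. by apply/eqP; rewrite rk0 eqxx. Qed.

Lemma root_notin_chain n p : e x n -> path forces n p -> x \notin n :: p.
Proof.
move=> xn pp; rewrite inE negb_or; apply/andP; split.
  by apply: contraTneq xn => ->; rewrite e_irr.
by apply/negP=> /(chain_par pp)[]; rewrite rk_root.
Qed.

(** A chord from [u] to a vertex beyond its successor [z] is impossible: the other neighbours of [u]
    rank below [z], while later vertices of the chain rank above it. *)
Lemma chain_induced n p : e x n -> path forces n p -> induced_path e (x :: n :: p).
Proof.
move=> xn pp; apply: (@induced_path_nth x) => //.
  by rewrite cons_uniq root_notin_chain // chain_uniq.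
case=> [|i] [|j] //; rewrite ltnS => /andP[lt_ij lt_j].
  (* Chords at [x]: its neighbours have rank 0, but every vertex of [p] has positive rank. *)
  case: j lt_ij lt_j => [|j] _ //= lt_j; apply: contraTF (mem_nth x lt_j).
  move=> /rk_nbr r0; apply/negP=> /(chain_par pp)[].
  by rewrite r0.
have {}lt_j : j < size (n :: p) by [].
have adj : forces (nth x (n :: p) i) (nth x (n :: p) i.+1).
  exact: (pathP x pp i (leq_trans lt_ij lt_j)).
rewrite eqSS; case: eqVneq => [->|nij]; first exact: forces_adj adj.
have lt_ij' : i.+1 < j by rewrite ltn_neqAle eq_sym nij.
have ltrk : rk (nth x (n :: p) i.+1) < rk (nth x (n :: p) j).
  apply: (sorted_ltn_nth rk_ltn_trans x (chain_rk (s := n :: p) pp)) => //.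
  by rewrite inE; apply: ltn_trans lt_j.
apply: contraTF ltrk => /(forces_nbr adj) lt_rk; rewrite -leqNgt ltnW //.
apply: lt_rk; rewrite -[nth x _ j.+1]/(nth x (n :: p) j).
by rewrite nth_uniq ?chain_uniq //; apply: ltn_trans lt_j.
Qed.

(** Ranks increase along the chain, so the vertex right after [y] has least rank in the subpath
    after [y]. *)
Lemma chain_successor n p y : e x n -> path forces n p ->
  y \in n :: p -> y != last n p ->
  exists z, [/\ forces y z, z \in subpath_after (x :: n :: p) y &
                forall w, w \in subpath_after (x :: n :: p) y -> rk z <= rk w].
Proof.
move=> xn pp yp nl.
have : uniq (x :: n :: p) by rewrite cons_uniq root_notin_chain // chain_uniq.
case/splitPl: yp pp nl => p1 [|z p2] ly; rewrite cat_path last_cat ly.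
  by rewrite /= eqxx.
move=> /= /and3P[_ yz pz] _; rewrite -[_ && _]/(uniq (x :: n :: p1 ++ z :: p2)).
have -> : x :: n :: p1 ++ z :: p2 = (x :: belast n p1) ++ y :: z :: p2.
  by rewrite /= -ly -(cat_rcons (last n p1)) -lastI.
rewrite cat_uniq => /and3P[_ /hasPn/(_ y (mem_head _ _)) ny _].
rewrite subpath_after_cat //; exists z; split=> //; first exact: mem_head.
by move=> w; rewrite inE => /predU1P[->//|/(chain_rk_gt pz)/ltnW].
Qed.

Lemma ranked_parallel_paths : exists k, internally_parallel_paths e k.
Proof.
have [p pP] := fin_all_exists maximal_chain.
(* One path is taken for every vertex [n]; when [n] is not a neighbour of [x] it is the one-vertex
   path at [x], which meets the others only in [x]. *)
pose c n := if e x n then n :: p n else [::].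
exists #|V|, x, (fun i => x :: c (enum_val i)); split.
- move=> i; split=> //; rewrite /c; case: ifP => [xn|_].
    by apply: chain_induced => //; case: (pP (enum_val i)).
  split=> // u v; rewrite !inE => /eqP-> /eqP->.
  by rewrite e_irr /= eqxx.
- move=> i j nij; apply/setP=> v; rewrite !inE -orb_andr.
  case: eqP => //= _; apply/negP=> /andP[].
  rewrite /c; case: ifP => // xi vi; case: ifP => // xj vj.
  move/eqP: nij; apply; apply: enum_val_inj.
  apply: chain_disjoint vi vj; rewrite ?rk_nbr //.
    by case: (pP (enum_val i)).
  by case: (pP (enum_val j)).
- apply/setP=> v; rewrite inE; apply/bigcupP.
  suff [->|[n vn]] : v = x \/ exists n, v \in c n.
  + by exists (enum_rank x) => //; rewrite inE mem_head.
  + by exists (enum_rank n) => //; rewrite inE enum_rankK inE vn orbT.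
  (* Induction on rank: a neighbour of [x] heads its own chain, and a vertex of positive rank lies
     on the chain of its parent. That parent is not [x], whose neighbours have rank 0. *)
  have [m] := ubnP (rk v); elim: m v => // m IH v lt_m.
  have [/eqP|v0] := posnP (rk v).
    by rewrite rk0 => /predU1P[->|xv]; [left|right; exists v; rewrite /c xv mem_head].
  have pv := par_adj v0.
  case: (IH (par v)) => [|eqx|[n]]; first exact: leq_trans (par_rk v0) _.
    by rewrite eqx in pv; rewrite (rk_nbr pv) in v0.
  move=> pvn; right; exists n; move: pvn; rewrite /c; case: ifP => // _ pvn.
  have [pp pl] := pP n.
  by apply: chain_next pvn _ => //; rewrite /forces v0 eqxx.
- move=> I y I0 Iy Y.
  have succ i : exists z, i \in I ->
    [/\ forces (y i) z, z \in subpath_after (x :: c (enum_val i)) (y i) &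
      forall w, w \in subpath_after (x :: c (enum_val i)) (y i) -> rk z <= rk w].
    have [iI|nI] := boolP (i \in I); last by exists x.
    (* Not being an end-vertex excludes [x], hence the one-vertex paths, and the last vertex of the
       chain. *)
    have [yQ] := Iy i iI; rewrite /end_vertex /= negb_or => /andP[nyx].
    move: yQ; rewrite inE (negPf nyx) /= /c; case: ifP => // xn yc nl.
    have [pp _] := pP (enum_val i).
    by have [z Hz] := chain_successor xn pp yc nl; exists z.
  have {succ} [z zP] := fin_all_exists succ.
  have [i0 i0I] := set0Pn _ I0.
  (* Choose [i] whose successor [z i] has least rank. A neighbour of [y i] other than [z i] ranks
     below [z i], whereas a vertex of [Y] on path [j] ranks at least [rk (z j)], hence at least
     [rk (z i)]. *)
  case: (arg_minnP (fun i => rk (z i)) i0I) => i iI imin.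
  have [yz zsub _] := zP i iI.
  exists i => //; rewrite (_ : [set _ in _ | _] = [set z i]) ?cards1 //.
  apply/setP=> u; rewrite !inE; apply/andP/eqP => [[/bigcupP[j jI]]|->].
    rewrite inE => uj yu; apply/eqP/negPn/negP=> /(forces_nbr yz yu).
    have [_ _ /(_ _ uj) le_zu] := zP j jI.
    by rewrite ltnNge (leq_trans (imin j jI) le_zu).
  by split; [apply/bigcupP; exists i; rewrite ?inE | apply: forces_adj].
Qed.

End Ranked.

(** * The ranking given by a power dominating vertex *)

Lemma power_dominating_ranking : power_dominating e [set x] ->
  exists (rk : V -> nat) (par : V -> V),
    [/\ forall v, (rk v == 0) = (v == x) || e x v,
        forall v, 0 < rk v -> rk (par v) < rk v,
        forall v, 0 < rk v -> e (par v) v &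
        forall v w, 0 < rk v -> e (par v) w -> w != v -> rk w < rk v].
Proof.
move=> /eqP pd; pose B t := blue_after e t [set x].
have exB v : exists t, v \in B t by exists #|V|; rewrite /B pd inE.
(* The rank is the first round in which [v] is blue; the parent will be a vertex, blue one round
   earlier, whose only non-blue neighbour was then [v]. *)
pose rk v := ex_minn (exB v).
have rkP v t : (v \in B t) = (rk v <= t).
  rewrite /rk; case: ex_minnP => m vm mmin; apply/idP/idP; first exact: mmin.
  by move=> le_mt; apply: (subsetP (blue_after_sub _ _ le_mt)).
have par_ex v : exists u, 0 < rk v ->
    rk u < rk v /\ nonblue_nbrs e (B (rk v).-1) u = [set v].
  have [v0|v_gt0] := posnP (rk v); first by exists v.
  have : v \in B (rk v).-1.+1 by rewrite prednK // rkP.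
  rewrite /B /blue_after /= !inE -[iter _ _ _]/(B _) rkP leqNgt prednK // leqnn /=.
  case/existsP=> u /andP[+ /eqP nu]; rewrite rkP => le_u; exists u; split=> //.
  by rewrite -(prednK v_gt0).
have {par_ex} [par parP] := fin_all_exists par_ex.
exists rk, par; split=> [v|v v0|v v0|v w v0 pw nwv].
- rewrite -leqn0 -rkP /B /blue_after /= !inE; congr (_ || _).
  apply/existsP/idP => [[u]|xv]; first by rewrite inE => /andP[/eqP->].
  by exists x; rewrite inE eqxx.
- by have [] := parP v v0.
- by have [_ /setP/(_ v)] := parP v v0; rewrite !inE eqxx => /andP[].
- have [_ /setP/(_ w)] := parP v v0; rewrite !inE pw (negPf nwv) /= => /negbFE.
  by rewrite rkP -ltnS prednK.
Qed.

End ForcingChains.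

(** * From parallel paths to a power dominating vertex *)

Lemma power_dominating_set0 (V : finType) (e : rel V) :
  power_dominating e set0 -> #|V| = 0.
Proof.
suff blue0 t : blue_after e t set0 = set0.
  by rewrite /power_dominating blue0 -cardsT => /eqP <-; rewrite cards0.
elim: t => [|t IH]; apply/setP => u; rewrite /blue_after /=.
  by rewrite !inE; apply/existsP=> -[w]; rewrite inE.
rewrite -/(blue_after e t set0) IH !inE.
by apply/existsP=> -[w]; rewrite inE.
Qed.

Lemma blue_after_stationary (V : finType) (e : rel V) S :
  exists t, force_step e (blue_after e t S) = blue_after e t S.
Proof.
(* With [#|V|.+1] rounds the growth alternative would need more than [#|V|] blue vertices. *)
have [|[s _ eqs]] := blue_after_card e #|V|.+1 S; last by exists s.
by rewrite ltnNge max_card.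
Qed.

Lemma parallel_paths_power_dominating (V : finType) (e : rel V) k :
  internally_parallel_paths e k -> exists x, power_dominating e [set x].
Proof.
case=> x [Q [Qpath _ Qcover Qforce]]; exists x; apply/power_dominatingP.
have [t stable] := blue_after_stationary e [set x]; exists t.
set B := blue_after e t [set x] in stable *.
have /subsetP B0 : closed_nbhd e [set x] \subset B by apply: (@blue_after_sub _ _ 0).
have xB : x \in B by apply: B0; rewrite !inE eqxx.
have nB v : e x v -> v \in B.
  move=> xv; apply: B0; rewrite !inE; apply/orP; right.
  by apply/existsP; exists x; rewrite inE eqxx.
pose I := [set i | has [predC B] (Q i)].
(* On a path that is not entirely blue, [z] is the first non-blue vertex and [y] its predecessor,
   which exists because the path starts at the blue vertex [x]. *)
have front i : exists y, i \in I ->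
    exists z s1 s2, [/\ Q i = s1 ++ y :: z :: s2, {subset rcons s1 y <= B},
       y \in B, z \notin B & ~~ end_vertex (Q i) y].
  have [iI|nI] := boolP (i \in I); last by exists x.
  have [[_ uQ indQ] hQ] := Qpath i.
  move: iI; rewrite inE => hasQ.
  have [z [s1 [s2 [eqQ nz ns1]]]] : exists z s1 s2,
      [/\ Q i = rcons s1 z ++ s2, z \notin B & ~~ has [predC B] s1].
    by case/split_find: hasQ => z s1 s2 nz ns1; exists z, s1, s2.
  case/lastP: s1 => [|s1 y] in ns1 eqQ *.
    by move: hQ nz; rewrite eqQ /= => -[->]; rewrite xB.
  exists y => _; exists z, s1, s2.
  have eqQ' : Q i = s1 ++ y :: z :: s2 by rewrite eqQ !cat_rcons.
  have s1B : {subset rcons s1 y <= B}.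
    by move=> v vs; apply: contraNT ns1 => nv; apply/hasP; exists v.
  split=> //; first by apply: s1B; rewrite mem_rcons mem_head.
  (* [y] is not last, since [z] follows it on a path without repetition; it is not [x], since [z]
     would then be a neighbour of [x] and so blue. *)
  rewrite /end_vertex eqQ' last_cat /= negb_or; apply/andP; split; last first.
    move: uQ; rewrite eqQ' cat_uniq => /and3P[_ _ /= /andP[ny _]].
    by apply: contraNneq ny => ->; apply: mem_last.
  case: s1 => [|a s1] /= in eqQ' {eqQ ns1 s1B} *; last first.
    move: uQ; rewrite eqQ' /= => /andP[+ _]; apply: contraNneq => ->.
    by rewrite mem_cat mem_head orbT.
  move: hQ; rewrite eqQ' /= => -[eqy]; case/negP: nz; apply: nB.
  rewrite -eqy indQ ?eqQ' ?inE ?eqxx ?orbT //= eqxx.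
  move: uQ; rewrite eqQ' /= inE negb_or => /andP[/andP[/negPf-> _] _].
  by rewrite eqxx.
have {front} [y yP] := fin_all_exists front.
apply/eqP; rewrite -subTset; apply/subsetP=> v _; apply/negPn/negP => vB.
have nonblue_I w i : w \notin B -> w \in Q i -> i \in I.
  by move=> wB wQ; rewrite inE; apply/hasP; exists w.
have coverQ w : exists i, w \in Q i.
  have : w \in [set: V] by rewrite inE.
  by rewrite -Qcover => /bigcupP[i _]; rewrite inE => wi; exists i.
have I0 : I != set0.
  by have [i /(nonblue_I _ _ vB) iI] := coverQ v; apply/set0Pn; exists i.
have subE i z s1 s2 : Q i = s1 ++ y i :: z :: s2 ->
    subpath_after (Q i) (y i) = z :: s2.
  move=> eqQ; rewrite eqQ subpath_after_cat //.
  have [[_ + _] _] := Qpath i.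
  by rewrite eqQ cat_uniq => /and3P[_ /hasPn/(_ _ (mem_head _ _))].
have [i iI|i iI] := Qforce I y I0.
  have [z [s1 [s2 [-> _ _ _ ->]]]] := yP i iI.
  by rewrite mem_cat mem_head orbT.
set Y := \bigcup_(j in I) _ => cardY.
(* A non-blue vertex lies on some path indexed by [I], and there it comes after [y j], as everything
   up to [y j] is blue. *)
have YB w : w \notin B -> w \in Y.
  move=> wB; have [j wj] := coverQ w; have jI := nonblue_I _ _ wB wj.
  apply/bigcupP; exists j => //; rewrite inE.
  have [z [s1 [s2 [eqQ s1B _ _ _]]]] := yP j jI.
  rewrite (subE _ _ _ _ eqQ).
  move: wj; rewrite eqQ -cat_rcons mem_cat => /orP[/s1B wB'|//].
  by rewrite wB' in wB.
have [z [s1 [s2 [eqQ _ yB zB _]]]] := yP i iI.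
have yz : e (y i) z.
  have [[_ uQ indQ] _] := Qpath i.
  rewrite indQ ?eqQ ?mem_cat ?inE ?eqxx ?orbT //; apply/orP; left.
  move: uQ; rewrite eqQ -cat_rcons; rewrite cat_uniq => /and3P[us /hasPn ns _].
  rewrite index_cat (negPf (ns _ (mem_head _ _))) /= eqxx addn0.
  rewrite index_cat mem_rcons mem_head -cats1 index_cat size_cat addn1.
  move: us; rewrite rcons_uniq => /andP[/negPf-> _].
  by rewrite /= eqxx addn0.
(* Contradiction with stationarity: [y i] can force [z]. Any non-blue neighbour of [y i] lies in
   [Y], where [y i] has a single neighbour, so it equals [z]. *)
apply: (negP zB); rewrite -stable /force_step !inE; apply/orP; right.
apply/existsP; exists (y i); rewrite yB /=; apply/eqP/setP => u; rewrite !inE.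
apply/andP/eqP => [[yu uB]|-> //].
have /eqP/cards1P[a /setP eqa] := cardY.
have := eqa u; have := eqa z; rewrite !inE yz yu !andbT !YB //.
by move=> /esym/eqP-> /esym/eqP.
Qed.

Theorem theorem5p2 (V : finType) (e : rel V)
    (e_sym : symmetric e) (e_irr : irreflexive e) :
  power_domination_number e = 1 <->
  exists k : nat, internally_parallel_paths e k.
Proof.
split=> [/power_domination_numberP[[S pdS /eqP/cards1P[x eqS]] _]|[k paths]].
  rewrite eqS in pdS.
  have [rk [par [rk0 par_rk par_adj par_force]]] := power_dominating_ranking pdS.
  exact: (ranked_parallel_paths e_sym e_irr rk0 par_rk par_adj par_force).
have [x pdx] := parallel_paths_power_dominating paths.
apply/power_domination_numberP; split; first by exists [set x]; rewrite ?cards1.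
(* Only the empty set must be excluded: it never colours anything, yet [x] is a vertex. *)
move=> S; rewrite lt0n; apply: contraTneq => /cards0_eq ->.
by apply/negP=> /power_dominating_set0 /card0_eq/(_ x).
Qed.
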